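(* Let $\mu$ be a finite Borel measure on $\mathbb{R}$ that is continuous (has no atoms). Let $m>\varsigma\ge0$ be real numbers. Assume that there exists a Borel set $A\subset\mathbb{R}$ with $\mu(A)>0$ such that for all $x\in A$, $$\limsup_{\epsilon\to0+}\epsilon^{-\varsigma}J_{\mu,m}(x,\epsilon)>0.$$ Then for every $q>1$, $$D_\mu^-(q)\le\varsigma.$$
   Context: For $m>0$, $x\in\mathbb{R}$, $\epsilon>0$, the $m$-Borel transform of $\mu$ is $J_{\mu,m}(x,\epsilon)=\epsilon^m\int_{\mathbb{R}}\frac{d\mu(y)}{|x-y|^m+\epsilon^m}$. For $q>0$ and $\epsilon>0$, let $S_\mu(q,\epsilon)=\sum_{j\in\mathbb{Z}}\big(\mu([j\epsilon,(j+1)\epsilon))\big)^q$. The lower multifractal dimension is $D_\mu^-(q)=\liminf_{\epsilon\to0+}\frac{\log S_\mu(q,\epsilon)}{(q-1)\log\epsilon}$. *)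

(* Defs.v *)
From mathcomp Require Import all_boot all_order all_algebra.
From mathcomp Require Import all_classical all_reals all_analysis.

Set Implicit Arguments.
Unset Strict Implicit.
Unset Printing Implicit Defensive.

Import Order.TTheory GRing.Theory Num.Theory.
Import numFieldNormedType.Exports.

Local Open Scope classical_set_scope.
Local Open Scope ring_scope.

(* [measurableTypeR R] is R with its Borel sigma-algebra (generated by the
   bounded intervals ]a, b]). *)

(* Real powers: [0 `^ m = 0] holds for [m != 0] (the transform is meant for
   m > 0), while [0 `^ 0 = 1]. *)
Definition borel_transform (R : realType)
    (mu : {finite_measure set (measurableTypeR R) -> \bar R})
    (m x eps : R) : \bar R :=
  ((eps `^ m)%:E *
   \int[mu]_(y in [set: measurableTypeR R])
      ((`|x - (y : R)| `^ m + eps `^ m)^-1)%:E)%E.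

Definition multifractal_sum (R : realType)
    (mu : {finite_measure set (measurableTypeR R) -> \bar R})
    (q eps : R) : \bar R :=
  \esum_(j in [set: int])
    (mu [set` `[(j%:~R * eps)%R, ((j + 1)%:~R * eps)%R[ ] `^ q)%E.

(* The logarithm of the sum is taken in the extended reals, since for q < 1
   the sum may be infinite.  For q != 1 the denominator is a nonzero real as
   soon as 0 < eps < 1. *)
Definition lower_multifractal_dim (R : realType)
    (mu : {finite_measure set (measurableTypeR R) -> \bar R})
    (q : R) : \bar R :=
  limf_einf
    (fun eps : R =>
       (lne (multifractal_sum mu q eps) / ((q - 1) * ln eps)%:E)%E)
    0^'+.

(* Main.v *)
(** Suppose [s < t < D^-(q)], so that the [q]-sum at mesh [eps] is at most
    [eps^(t(q-1))] for small [eps], and choose [s < a < b < t] with [a <= m].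
    Call a cell of the mesh [2^-n] heavy when it and its two neighbours carry
    mass at least [2^(-bn)].  By Chebyshev's inequality the union [F_n] of the
    heavy cells has mass [O(2^(-n(t-b)(q-1)))], so by Borel-Cantelli almost every
    [x] lies in only finitely many [F_n], and then
    [mu (B(x, 2^-n)) = O(2^(-bn))].  For such [x] the [a]-potential
    [\int |x - y|^(-a) dmu(y)] is finite; since the kernel of the Borel transform
    is at most [(eps / |x - y|)^a], we get [J(x, eps) = O(eps^a) = o(eps^s)], so
    the set [A] would be null. *)
Require Import Defs.
From mathcomp Require Import all_boot all_order all_algebra.
From mathcomp Require Import all_classical all_reals all_analysis.
From mathcomp Require Import measurable_realfun lra ring.
Import Order.TTheory GRing.Theory Num.Theory.
Import numFieldNormedType.Exports.
Local Open Scope classical_set_scope.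
Local Open Scope ring_scope.

Set Implicit Arguments.
Unset Strict Implicit.
Unset Printing Implicit Defensive.

(** * Nonnegative series and countable subadditivity *)

Lemma nneseries_geometric_le (R : realType) (c r : R) : 0 <= c -> 0 < r < 1 ->
  (\sum_(0 <= n <oo) (c * r ^+ n)%:E <= (c / (1 - r))%:E)%E.
Proof.
move=> c0 /andP[r0 r1]; apply: lime_le.
  apply: is_cvg_nneseries => n _ _.
  by rewrite lee_fin mulr_ge0 ?exprn_ge0 ?(ltW r0).
apply: nearW => n; rewrite sumEFin lee_fin.
have := @geometric_le_lim R n c r c0 r0; rewrite gtr0_norm//; exact.
Qed.

Lemma le_esumZl (R : realType) (T : choiceType) (I : set T) (c : R)
    (a : T -> \bar R) : 0 <= c -> (forall i, (0 <= a i)%E) ->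
  (\esum_(i in I) (c%:E * a i) <= c%:E * \esum_(i in I) a i)%E.
Proof.
move=> c0 a0; apply: ge_ereal_sup => _ [X [finX XI] <-].
rewrite -ge0_mule_fsumr//; apply: lee_wpmul2l; first by rewrite lee_fin.
by apply: esum_ge; exists X.
Qed.

(** The mesh cells are indexed by [int]; the family is carried to [nat] along [pickle], with the
    empty set at codes outside [G], where sigma-subadditivity applies. *)
Lemma le_measure_bigcup_countType d (T : measurableType d) (R : realType)
    (mu : {measure set T -> \bar R}) (I : countType) (G : set I)
    (F : I -> set T) : (forall j, measurable (F j)) ->
  (mu (\bigcup_(j in G) F j) <= \esum_(j in G) mu (F j))%E.
Proof.
move=> mF; pose H n := if @pickle_inv I n is Some j then F j else set0.
have mH n : measurable (H n) by rewrite /H; case: pickle_inv.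
have HF j : H (pickle j) = F j by rewrite /H pickleK_inv.
under eq_bigcupr do rewrite -HF.
under eq_esum do rewrite -HF.
rewrite -bigcup_image -(@esum_image R _ _ G pickle (mu \o H)); last first.
  by move=> i j _ _ /(pcan_inj pickleK).
rewrite bigcup_mkcond esum_mkcond -nneseries_esumT => [|n]; last by case: ifP.
pose K n := if n \in [set pickle x | x in G] then H n else set0.
have mK n : measurable (K n) by rewrite /K; case: ifP.
have mUK := bigcupT_measurable _ mK.
apply: (le_trans (measure_sigma_subadditive mu mK mUK (fun x => id))).
by apply: lee_nneseries => // n _; rewrite /K; case: ifP; rewrite ?measure0.
Qed.

(** * Chebyshev's inequality for the cells of a mesh *)

Lemma powRD3_le (R : realType) (q a b c : R) :
    0 <= q -> 0 <= a -> 0 <= b -> 0 <= c ->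
  (a + b + c) `^ q <= 3 `^ q * (a `^ q + b `^ q + c `^ q).
Proof.
move=> q0 a0 b0 c0.
(* The sum is at most three times its largest summand [x]; the case analysis below finds which one
   that is. *)
have key x : 0 <= x -> a <= x -> b <= x -> c <= x ->
    (a + b + c) `^ q <= 3 `^ q * x `^ q.
  move=> x0 ax bx cx.
  rewrite -powRM// ge0_ler_powR ?nnegrE ?addr_ge0 ?mulr_ge0//.
  lra.
have pw x := powR_ge0 x q.
have le x : x \in [:: a; b; c] ->
    3 `^ q * x `^ q <= 3 `^ q * (a `^ q + b `^ q + c `^ q).
  move=> xs; rewrite ler_wpM2l//.
  have := pw a; have := pw b; have := pw c.
  by move: xs; rewrite !inE => /or3P[] /eqP ->; lra.
have [ab|/ltW ba] := leP a b;
  [have [bc|/ltW cb] := leP b c|have [ac|/ltW ca] := leP a c].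
- apply: le_trans (le c _); last by rewrite !inE eqxx !orbT.
  exact: key (le_trans ab bc) _ _.
- apply: le_trans (le b _); last by rewrite !inE eqxx !orbT.
  exact: key.
- apply: le_trans (le c _); last by rewrite !inE eqxx !orbT.
  exact: key _ (le_trans ba ac) _.
- apply: le_trans (le a _); last by rewrite !inE eqxx.
  exact: key.
Qed.

Definition mesh (R : realType) (eps : R) (j : int) : set R :=
  [set` `[(j%:~R * eps)%R, ((j + 1)%:~R * eps)%R[ ].

Lemma measurable_mesh (R : realType) (eps : R) (j : int) :
  measurable (mesh eps j : set (measurableTypeR R)).
Proof. exact: measurable_itv. Qed.

Lemma multifractal_sum_shift (R : realType)
    (mu : {finite_measure set (measurableTypeR R) -> \bar R}) (q eps : R)
    (k : int) :
  (\esum_(j in [set: int]) (mu (mesh eps (j + k)) `^ q) =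
   multifractal_sum mu q eps)%E.
Proof.
apply/esym; apply: (@reindex_esum _ _ _ setT setT (fun j : int => j + k)
  (fun j => mu (mesh eps j) `^ q)%E).
split=> // [i j _ _ /addIr//|j _].
by exists (j - k) => //; rewrite subrK.
Qed.

(** If a cell and its neighbours have total mass [M >= theta], then the cell has mass at most
    [M <= M ^ q * theta ^ (1 - q)], because [q > 1]. Splitting [M ^ q] by [powRD3_le] costs [3 ^ q];
    summing over cells gives three translates of the same q-sum, hence the last factor 3. *)
Lemma measure_heavy_cells_le (R : realType)
    (mu : {finite_measure set (measurableTypeR R) -> \bar R})
    (q eps theta : R) : 1 < q -> 0 < theta ->
  (mu (\bigcup_(j in [set j | theta%:E <=
      mu (mesh eps (j - 1)) + mu (mesh eps j) + mu (mesh eps (j + 1))]%E)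
      mesh eps j) <=
   (3 `^ q * theta `^ (1 - q) * 3)%:E * multifractal_sum mu q eps)%E.
Proof.
move=> q1 theta0; set G := [set j | _].
have q0 : 0 < q by apply: lt_trans q1.
pose p j := fine (mu (mesh eps j)).
have pE j : mu (mesh eps j) = (p j)%:E.
  by rewrite fineK// fin_num_measure//; exact: measurable_mesh.
have p0 j : 0 <= p j by rewrite -lee_fin -pE.
pose K := 3 `^ q * theta `^ (1 - q).
have K0 : 0 <= K by rewrite mulr_ge0 ?powR_ge0.
(* The [j + 0] gives all three terms the shape required by [multifractal_sum_shift]. *)
pose S j := (mu (mesh eps (j - 1)) `^ q + mu (mesh eps (j + 0)) `^ q
  + mu (mesh eps (j + 1)) `^ q)%E.
have S0 j : (0 <= S j)%E by rewrite !adde_ge0// poweR_ge0.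
have GS j : G j -> (mu (mesh eps j) <= K%:E * S j)%E.
  rewrite /G /S /= addr0 !pE /= -!EFinD -EFinM !lee_fin => thetaM.
  set M := p _ + _ + _ in thetaM *.
  have M0 : 0 < M by apply: lt_le_trans thetaM.
  apply: (@le_trans _ _ M).
    by rewrite /M; have := p0 (j - 1); have := p0 (j + 1); lra.
  apply: (@le_trans _ _ (M `^ q * theta `^ (1 - q))); last first.
    rewrite /K -!mulrA [X in _ <= _ * X]mulrC mulrA ler_wpM2r ?powR_ge0//.
    by rewrite powRD3_le ?p0// ltW.
  rewrite -(mulr_powRB1 (ltW M0) q0) -mulrA ler_peMr ?(ltW M0)//.
  rewrite -(opprB q) powRN ler_pdivlMr ?powR_gt0// mul1r.
  by rewrite ge0_ler_powR ?nnegrE ?subr_ge0 ?(ltW q1) ?(ltW theta0) ?(ltW M0).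
apply: le_trans (le_measure_bigcup_countType mu _ _) _.
  by move=> j; exact: measurable_mesh.
rewrite esum_mkcond.
apply: (@le_trans _ _ (\esum_(j in [set: int]) (K%:E * S j))%E).
  apply: le_esum => j _; case: ifPn => [/set_mem /GS//|_].
  by rewrite mule_ge0 ?lee_fin.
apply: le_trans (le_esumZl _ K0 S0) _.
rewrite [in leRHS]EFinM -muleA lee_wpmul2l ?lee_fin//.
rewrite /S esumD ?esumD => *; rewrite ?adde_ge0 ?poweR_ge0//.
rewrite !multifractal_sum_shift.
have -> : (3%:E = 1 + 1 + 1 :> \bar R)%E by rewrite -!EFinD; congr EFin; ring.
have sum0 : (0 <= multifractal_sum mu q eps)%E.
  by apply: esum_ge0 => j _; exact: poweR_ge0.
by rewrite !ge0_muleDl ?mul1e ?adde_ge0.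
Qed.

(** * From the lower dimension to a power bound on the q-sum *)

Lemma lower_multifractal_dim_gt (R : realType)
    (mu : {finite_measure set (measurableTypeR R) -> \bar R}) (q s : R) :
    1 < q -> (s%:E < lower_multifractal_dim mu q)%E ->
  exists t delta, [/\ s < t, 0 < delta & forall eps, 0 < eps < delta ->
    (multifractal_sum mu q eps <= (eps `^ (t * (q - 1)))%:E)%E].
Proof.
move=> q1; rewrite /lower_multifractal_dim limf_einfE.
move=> /ereal_sup_gt[_ [V V0 <-] sV].
(* [t] is the infimum over [V] itself when that is finite, and [s + 1] when it is infinite. *)
have [t st tV] : exists2 t, s < t & (t%:E <= ereal_inf [set
    (lne (multifractal_sum mu q x) / ((q - 1) * ln x)%:E)%E | x in V])%E.
  case: ereal_inf sV => [r|_|//].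
    by rewrite lte_fin; exists r.
  by exists (s + 1); rewrite ?ltrDl ?leey.
move: V0 => /nbhs_ballP[d /= d0 dV].
(* The cap at 1 makes [ln eps] negative. *)
exists t, (Num.min d 1); split => //; first by rewrite lt_min d0 ltr01.
move=> eps /andP[eps0]; rewrite lt_min => /andP[epsd eps1].
have Veps : V eps.
  by apply: dV => //; rewrite /ball /= sub0r normrN gtr0_norm.
have {tV} : (t%:E <= lne (multifractal_sum mu q eps) / ((q - 1) * ln eps)%:E)%E.
  by apply: le_trans tV _; apply: ereal_inf_lbound; exists eps.
have c0 : (q - 1) * ln eps < 0 by rewrite pmulr_rlt0 ?subr_gt0// ln_lt0// eps0.
have pw0 := powR_ge0 eps (t * (q - 1)).
(* The value [+oo] is excluded, since its quotient by a negative number is [-oo]; for a real value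
   that is not positive the bound is trivial. *)
case: (multifractal_sum mu q eps) => [r||]; last by rewrite leNye.
- rewrite /= /inve lt_eqF//; case: ifPn => [r0 _|].
    by rewrite lee_fin (le_trans r0).
  rewrite -ltNge => r0; rewrite -EFinM !lee_fin ler_ndivlMr// => rt.
  by rewrite /powR gt_eqF// -[leLHS]lnK ?posrE// ler_expR -mulrA.
- by rewrite /= /inve lt_eqF//= mulyr ltr0_sg ?invr_lt0// mulN1e leeNy_eq.
Qed.

(** * Dyadic potentials and the Borel transform *)

Lemma powRX (R : realType) (x a : R) (n : nat) : 0 <= x ->
  (x ^+ n) `^ a = (x `^ a) ^+ n.
Proof. by move=> x0; rewrite -!powR_mulrn ?powR_ge0// powRAC. Qed.

Lemma dyadic_bracket (R : realType) (r : R) : 0 < r < 1 ->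
  exists n, 2^-1 ^+ n.+1 <= r < 2^-1 ^+ n.
Proof.
move=> /andP[r0 r1].
have ex : exists n, 2^-1 ^+ n <= r.
  exists (Num.trunc r^-1).+1.
  rewrite exprVn -[leRHS]invrK lef_pV2 ?posrE ?invr_gt0 ?exprn_gt0//.
  have rV0 : 0 <= r^-1 by rewrite invr_ge0 ltW.
  have /andP[_ /ltW] := truncn_itv rV0; move/le_trans; apply.
  by rewrite -natrX ler_nat ltnW// ltn_expl.
case: (ex_minnP ex) => -[|n] rn nmin; first by move: rn; rewrite expr0 leNgt r1.
by exists n; rewrite rn ltNge; apply/negP => /nmin; rewrite ltnn.
Qed.

(* The maximum with [eps] avoids the junk value [0 `^ (- a) = 0] at [d = 0]. *)
Lemma powRN_dyadic_le (R : realType) (a d eps : R) : 0 <= a -> 0 < eps ->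
  (((Num.max d eps) `^ (- a))%:E <=
   1 + \sum_(0 <= n <oo)
         ((2^-1 `^ (- a)) ^+ n.+1 * (d < 2^-1 ^+ n)%R%:R)%:E)%E.
Proof.
move=> a0 eps0; set r := Num.max _ _.
have r0 : 0 < r by rewrite lt_max eps0 orbT.
have powN x y : 0 < x -> x <= y -> y `^ (- a) <= x `^ (- a).
  move=> x0 xy; have y0 := lt_le_trans x0 xy.
  rewrite !powRN lef_pV2 ?posrE ?powR_gt0//.
  by rewrite ge0_ler_powR ?nnegrE ?(ltW x0) ?(ltW y0).
have term0 n :
    (0 <= ((2^-1 `^ (- a)) ^+ n.+1 * (d < 2^-1 ^+ n)%R%:R)%:E :> \bar R)%E.
  by rewrite lee_fin mulr_ge0 ?exprn_ge0 ?powR_ge0.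
have [r1|r1] := leP 1 r.
  apply: (@le_trans _ _ 1%E); last by rewrite leeDl// nneseries_ge0.
  by have := powN 1 r ltr01 r1; rewrite powR1 lee_fin.
have [n /andP[nr rn]] := dyadic_bracket (introT andP (conj r0 r1)).
have dn : d < 2^-1 ^+ n by apply: le_lt_trans rn; rewrite le_max lexx.
(* The single term at the [n] bracketing [r] is large enough, because [r >= 2^-(n+1)]; this is why
   the exponent is [n.+1] while the indicator uses [n]. *)
apply: (@le_trans _ _ ((2^-1 `^ (- a)) ^+ n.+1 * (d < 2^-1 ^+ n)%R%:R)%:E).
  by rewrite dn mulr1 lee_fin -powRX// powN// exprn_gt0.
apply: (@le_trans _ _ (\sum_(0 <= n <oo)
         ((2^-1 `^ (- a)) ^+ n.+1 * (d < 2^-1 ^+ n)%R%:R)%:E)%E); last first.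
  by rewrite leeDr.
apply: le_trans (nneseries_lim_ge n.+1 _) => //.
by rewrite big_nat_recr//= leeDr// sume_ge0.
Qed.

(** The denominator is at least [r ^ m] for [r] the maximum, so the kernel is at most
    [(eps / r) ^ m]; as [eps / r <= 1], lowering the exponent to [a] only increases this. *)
Lemma borel_kernel_le (R : realType) (d eps a m : R) :
    0 <= d -> 0 < eps -> 0 <= a <= m ->
  eps `^ m * (d `^ m + eps `^ m)^-1 <= eps `^ a * (Num.max d eps) `^ (- a).
Proof.
move=> d0 eps0 /andP[a0 am]; set r := Num.max _ _.
have r0 : 0 < r by rewrite lt_max eps0 orbT.
have epsr : eps <= r by rewrite le_max lexx orbT.
have E b : eps `^ b * r `^ (- b) = (eps / r) `^ b.
  rewrite powRM ?invr_ge0 ?(ltW eps0) ?(ltW r0)// -[r^-1]powR_inv1 ?(ltW r0)//.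
  by rewrite -powRrM mulN1r.
apply: (@le_trans _ _ (eps `^ m * r `^ (- m))); last first.
  by rewrite !E ger_powR// divr_gt0//= ler_pdivrMr// mul1r.
rewrite ler_wpM2l ?powR_ge0// powRN lef_pV2 ?posrE ?powR_gt0//; last first.
  by rewrite ltr_wpDl ?powR_ge0 ?powR_gt0.
by rewrite /r; case: (leP d eps) => _; rewrite ?lerDl ?lerDr powR_ge0.
Qed.

Lemma measurable_dist_lt (R : realType) (x r : R) :
  measurable ([set y : R | (`|x - y| < r)%R] : set (measurableTypeR R)).
Proof.
rewrite (_ : [set _ | _] = [set` `]x - r, x + r[ ]).
  exact: measurable_itv.
by apply/seteqP; split=> y; rewrite /= in_itv /= ltr_distlC.
Qed.

Lemma powR_half_itv (R : realType) (a : R) : 0 < a -> 0 < (2^-1 : R) `^ a < 1.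
Proof.
move=> a0; rewrite powR_gt0//=.
have := gt0_ltr_powR a0 (_ : 2^-1 \is Num.nneg) (_ : 1 \is Num.nneg).
by rewrite powR1; apply; rewrite ?nnegrE// invf_lt1 ?ltr1n.
Qed.

(** The kernel is at most [eps ^ a] times a dyadic series that no longer involves [eps]. Integrated
    term by term, its n-th term is at most a constant times [2^(-(b - a) n)], which is summable
    because [a < b]. *)
Lemma borel_transform_le (R : realType)
    (mu : {finite_measure set (measurableTypeR R) -> \bar R})
    (m x a b c : R) : 0 <= a <= m -> a < b ->
    (forall n, (mu [set y : R | (`|x - y| < 2^-1 ^+ n)%R] <=
                (c * (2^-1 `^ b) ^+ n)%:E)%E) ->
  exists K : R, forall eps : R, 0 < eps ->
    (borel_transform mu m x eps <= (eps `^ a * K)%:E)%E.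
Proof.
move=> /andP[a0 am] ab muB.
pose w : R := 2^-1 `^ (- a).
have w0 : 0 < w by rewrite powR_gt0.
pose B n : set (measurableTypeR R) := [set y : R | (`|x - y| < 2^-1 ^+ n)%R].
have mnorm : measurable_fun [set: measurableTypeR R] (fun y : R => `|x - y|).
  by apply: measurableT_comp => //; exact: measurable_funB.
have mB n : measurable (B n) by exact: measurable_dist_lt.
pose g n (y : measurableTypeR R) : \bar R :=
  (w ^+ n.+1 * (`|x - (y : R)| < 2^-1 ^+ n)%R%:R)%:E.
have g0 n y : (0 <= g n y)%E by rewrite lee_fin mulr_ge0// exprn_ge0// ltW.
have gE n : g n = (fun y => (w ^+ n.+1)%:E * (\1_(B n) y)%:E)%E.
  apply/funext => y; rewrite /g EFinM; congr (_ * (_%:R)%:E)%E.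
  by rewrite /B; congr nat_of_bool; apply/idP/idP => [?|/set_mem//]; rewrite inE.
have mg n : measurable_fun setT (g n).
  by rewrite gE; apply/measurable_EFinP; exact: measurable_funM.
have mS : measurable_fun setT (fun y => \sum_(0 <= n <oo) g n y)%E.
  by apply: ge0_emeasurable_sum.
have S0 y : (0 <= \sum_(0 <= n <oo) g n y)%E by apply: nneseries_ge0.
have intg n : (\int[mu]_y g n y <= (c * w * (2^-1 `^ (b - a)) ^+ n)%:E)%E.
  rewrite gE ge0_integralZl_EFin ?exprn_ge0 ?(ltW w0)//; last first.
  - by apply/measurable_EFinP; exact: measurable_indic.
  rewrite integral_indic// setIT.
  apply: le_trans (lee_wpmul2l _ (muB n)) _.
    by rewrite lee_fin exprn_ge0// ltW.
  rewrite -EFinM lee_fin powRD ?pnatr_eq0 ?implybT//; last first.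
    by rewrite invr_eq0 pnatr_eq0 implybT.
  by rewrite exprMn exprS -/w; lra.
have c0 : 0 <= c.
  by have := le_trans (measure_ge0 mu _) (muB 0); rewrite expr0 mulr1 lee_fin.
have r01 : 0 < (2^-1 : R) `^ (b - a) < 1 by rewrite powR_half_itv// subr_gt0.
have int_sum : (\int[mu]_y (1 + \sum_(0 <= n <oo) g n y) <=
    (fine (mu setT) + c * w / (1 - 2^-1 `^ (b - a)))%:E)%E.
  rewrite ge0_integralD// EFinD leeD//.
    by rewrite integral_cst// mul1e fineK// fin_num_measure.
  rewrite integral_nneseries//.
  apply: le_trans (nneseries_geometric_le _ r01); last by rewrite mulr_ge0// ltW.
  by apply: lee_nneseries => n _ //; rewrite integral_ge0.
(* The witness [K] is the bound in [int_sum]: the total mass plus the sum of the geometric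
   series. *)
eexists => eps eps0; rewrite EFinM.
apply: le_trans (lee_wpmul2l _ int_sum); last by rewrite lee_fin powR_ge0.
have mk : measurable_fun [set: measurableTypeR R]
    (fun y : R => ((`|x - y| `^ m + eps `^ m)^-1)%:E).
  apply/measurable_EFinP.
  under eq_fun do rewrite -powR_inv1 ?addr_ge0 ?powR_ge0//.
  apply: (measurableT_comp (measurable_powR _)).
  apply: measurable_funD => //.
  exact: (measurableT_comp (measurable_powR _)).
rewrite /borel_transform -ge0_integralZl_EFin ?powR_ge0//; last first.
  by move=> y _; rewrite lee_fin invr_ge0 addr_ge0 ?powR_ge0.
rewrite -ge0_integralZl_EFin ?powR_ge0//; last 2 first.
- by move=> y _; rewrite adde_ge0.
- exact: emeasurable_funD.
apply: ge0_le_integral => //.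
- by move=> y _; rewrite -EFinM lee_fin mulr_ge0 ?invr_ge0 ?addr_ge0 ?powR_ge0.
- by apply: emeasurable_funM.
- by apply: emeasurable_funM => //; exact: emeasurable_funD.
move=> y _; rewrite -EFinM.
apply: (@le_trans _ _ (eps `^ a * (Num.max `|x - (y : R)| eps) `^ (- a))%:E).
  by rewrite lee_fin borel_kernel_le// a0.
rewrite EFinM lee_wpmul2l ?lee_fin ?powR_ge0//; exact: powRN_dyadic_le.
Qed.

(** The function is at most [K * eps ^ (a - s)], which tends to 0 because [s < a]. *)
Lemma limf_esup_borel_transform_le0 (R : realType)
    (mu : {finite_measure set (measurableTypeR R) -> \bar R})
    (m x s a K : R) : s < a ->
    (forall eps, 0 < eps ->
      (borel_transform mu m x eps <= (eps `^ a * K)%:E)%E) ->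
  (limf_esup (fun eps : R => (eps `^ (- s))%:E * borel_transform mu m x eps)
     0^'+ <= 0)%E.
Proof.
move=> sa JK; rewrite limf_esupE; apply/lee_addgt0Pr => e e0; rewrite add0e.
have cvg0 : eps `^ (a - s) * K @[eps --> 0^'+] --> 0 * K.
  by apply: cvgMl; apply: powR_cvg0; rewrite subr_gt0.
rewrite mul0r in cvg0.
pose V := [set eps : R | 0 < eps /\ eps `^ (a - s) * K < e].
have V0 : 0^'+ V.
  near=> eps; split; first by near: eps; exact: nbhs_right_gt.
  by near: eps; exact: (cvgr_lt 0).
apply: (@le_trans _ _ (ereal_sup ((fun eps : R =>
    (eps `^ (- s))%:E * borel_transform mu m x eps)%E @` V))).
  by apply: ereal_inf_lbound; exists V.
apply: ge_ereal_sup => _ [eps [eps0 epse] <-].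
apply: le_trans (lee_wpmul2l _ (JK _ eps0)) _.
  by rewrite lee_fin powR_ge0.
rewrite -EFinM lee_fin mulrA -powRD ?(gt_eqF eps0) ?implybT// (addrC (- s)).
exact: ltW.
Unshelve. all: by end_near. Qed.

(** * Balls, heavy cells and Borel-Cantelli *)

Lemma measure_ball_le_mesh (R : realType)
    (mu : {finite_measure set (measurableTypeR R) -> \bar R}) (eps x : R)
    (j : int) : 0 < eps -> mesh eps j x ->
  (mu [set y : R | (`|x - y| < eps)%R] <=
   mu (mesh eps (j - 1)) + mu (mesh eps j) + mu (mesh eps (j + 1)))%E.
Proof.
move=> eps0 xj.
have {xj}/andP[jx xj] : j%:~R * eps <= x < (j%:~R + 1%:~R) * eps.
  by move: xj; rewrite /mesh /= in_itv /= rmorphD.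
have mB := measurable_dist_lt x eps.
have mm k := @measurable_mesh R eps k.
have mU := measurableU _ _ (measurableU _ _ (mm (j - 1)) (mm j)) (mm (j + 1)).
apply: (@le_trans _ _
    (mu ((mesh eps (j - 1) `|` mesh eps j) `|` mesh eps (j + 1)))).
  apply: le_measure; rewrite ?inE// => y /=; rewrite ltr_distlC => /andP[xy yx].
  rewrite /mesh /= !in_itv /= !rmorphD /= rmorphN /=.
  (* A point within [eps] of cell [j] lies in the cell to its left, in it, or in the cell to its
     right. *)
  have [yj|jy] := ltP y (j%:~R * eps).
    by left; left; apply/andP; split; lra.
  have [yj|jy'] := ltP y ((j%:~R + 1%:~R) * eps).
    by left; right; apply/andP; split; lra.
  by right; apply/andP; split; lra.
apply: (@le_trans _ _
    (mu (mesh eps (j - 1) `|` mesh eps j) + mu (mesh eps (j + 1)))%E).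
  by apply: measureU2 => //; exact: measurableU.
by apply: leeD => //; exact: measureU2.
Qed.

(** The terms before [N] are absorbed into the constant: there [r ^ n >= r ^ N], so
    [M <= (M / r ^ N) * r ^ n]. *)
Lemma eventually_geometric_le (R : realType) (u : nat -> \bar R) (M c r : R)
    (N : nat) : 0 <= M -> 0 <= c -> 0 < r < 1 ->
    (forall n, (u n <= M%:E)%E) ->
    (forall n, (N <= n)%N -> (u n <= (c * r ^+ n)%:E)%E) ->
  exists2 c' : R, 0 <= c' & forall n, (u n <= (c' * r ^+ n)%:E)%E.
Proof.
move=> M0 c0 /andP[r0 r1] uM uc.
have rN n : 0 < r ^+ n by exact: exprn_gt0.
exists (c + M / r ^+ N); first by rewrite addr_ge0// divr_ge0// ltW.
move=> n; rewrite mulrDl; have [Nn|nN] := leqP N n.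
  apply: le_trans (uc _ Nn) _.
  by rewrite lee_fin lerDl mulr_ge0 ?divr_ge0 ?(ltW (rN _)).
apply: le_trans (uM n) _; rewrite lee_fin.
apply: (@le_trans _ _ (M / r ^+ N * r ^+ n)).
  rewrite -mulrA ler_peMr// mulrC ler_pdivlMr// mul1r.
  by rewrite ler_wiXn2l ?(ltW r0) ?(ltW r1) ?(ltnW nN).
by rewrite lerDr mulr_ge0 ?(ltW (rN _)).
Qed.

(** This is the set [F_n]. Neighbours count because a ball of radius [2^-n] about a point of a cell
    may spill into them. *)
Definition heavy_cells (R : realType)
    (mu : {finite_measure set (measurableTypeR R) -> \bar R}) (b : R) (n : nat) :
    set R :=
  \bigcup_(j in [set j | ((2^-1 `^ b) ^+ n)%:E <=
      mu (mesh (2^-1 ^+ n) (j - 1)) + mu (mesh (2^-1 ^+ n) j)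
      + mu (mesh (2^-1 ^+ n) (j + 1))]%E) mesh (2^-1 ^+ n) j.

Lemma measurable_heavy_cells (R : realType)
    (mu : {finite_measure set (measurableTypeR R) -> \bar R}) (b : R) (n : nat) :
  measurable (heavy_cells mu b n : set (measurableTypeR R)).
Proof.
rewrite /heavy_cells bigcup_mkcond.
apply: countable_bigcupT_measurable => [|j]; first exact: countableP.
by case: ifP => // _; exact: measurable_mesh.
Qed.

(** The Chebyshev factor [2^(-bn(1-q))] times the q-sum bound [2^(-nt(q-1))] is [2^(-n(t-b)(q-1))],
    summable since [b < t] and [q > 1]. *)
Lemma measure_lim_sup_heavy_cells (R : realType)
    (mu : {finite_measure set (measurableTypeR R) -> \bar R})
    (q b t delta : R) : 1 < q -> b < t -> 0 < delta ->
    (forall eps, 0 < eps < delta ->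
      (multifractal_sum mu q eps <= (eps `^ (t * (q - 1)))%:E)%E) ->
  mu (lim_sup_set (heavy_cells mu b)) = 0%E.
Proof.
move=> q1 bt delta0 sum_le.
have h0 : 0 < 2^-1 :> R by rewrite invr_gt0.
have r01 : 0 < (2^-1 : R) `^ ((t - b) * (q - 1)) < 1.
  by rewrite powR_half_itv// mulr_gt0 ?subr_gt0.
have [N deltaN] : exists N, forall n, (N <= n)%N -> (2^-1 : R) ^+ n < delta.
  have : (2^-1 : R) ^+ n @[n --> \oo] --> 0.
    by apply: cvg_expr; rewrite gtr0_norm// invf_lt1 ?ltr1n.
  by move=> /(cvgr_lt 0)/(_ _ delta0)[N _ NP]; exists N => n Nn; exact: NP.
pose M := fine (mu setT).
have muT : mu setT = M%:E by rewrite fineK// fin_num_measure.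
have [c c0 muF] : exists2 c, 0 <= c & forall n, (mu (heavy_cells mu b n) <=
    (c * (2^-1 `^ ((t - b) * (q - 1))) ^+ n)%:E)%E.
  (* Before [N], where the mesh may exceed [delta], only the total mass is available as a bound. *)
  apply: (@eventually_geometric_le _ _ M (3 `^ q * 3) _ N) => //.
  - by rewrite -lee_fin -muT.
  - move=> n; rewrite -muT le_measure ?inE//; exact: measurable_heavy_cells.
  move=> n Nn; have hn0 : 0 < (2^-1 : R) ^+ n by rewrite exprn_gt0.
  apply: le_trans (measure_heavy_cells_le _ _ q1 _) _.
    by rewrite exprn_gt0// powR_gt0.
  apply: le_trans (lee_wpmul2l _ (sum_le _ _)) _.
  - by rewrite lee_fin !mulr_ge0 ?powR_ge0.
  - by rewrite hn0 deltaN.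
  rewrite -EFinM lee_fin -!powRX ?powR_ge0// ?(ltW h0)//.
  rewrite -powRrM [_ * 3]mulrAC -[leLHS]mulrA.
  rewrite ler_wpM2l ?mulr_ge0 ?powR_ge0//.
  rewrite -powRD ?(gt_eqF hn0) ?implybT//.
  by rewrite (_ : b * (1 - q) + t * (q - 1) = (t - b) * (q - 1)); last ring.
(* This is the Borel-Cantelli lemma. *)
apply: lim_sup_set_cvg0; first by move=> n; exact: measurable_heavy_cells.
apply: le_lt_trans (ltry _).
apply: le_trans (nneseries_geometric_le c0 r01).
by apply: lee_nneseries => // n _; exact: muF.
Qed.

(** From some [n] on, the cell containing [x] is not heavy, so it and its neighbours, which cover
    the ball, have mass below [2^(-bn)]. *)
Lemma measure_ball_le_notin_lim_sup (R : realType)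
    (mu : {finite_measure set (measurableTypeR R) -> \bar R}) (b x : R) :
    0 < b -> ~ lim_sup_set (heavy_cells mu b) x ->
  exists c : R, forall n, (mu [set y : R | (`|x - y| < 2^-1 ^+ n)%R] <=
    (c * (2^-1 `^ b) ^+ n)%:E)%E.
Proof.
move=> b0 xF.
have [N FN] : exists N, forall n, (N <= n)%N -> ~ heavy_cells mu b n x.
  apply: contrapT => noN; apply: xF => N _; apply: contrapT => noF.
  by apply: noN; exists N => n Nn Fn; apply: noF; exists n.
pose M := fine (mu setT).
have muT : mu setT = M%:E by rewrite fineK// fin_num_measure.
have r01 := @powR_half_itv R b b0.
have [||||c _ muB] := @eventually_geometric_le R
    (fun n => mu [set y : R | (`|x - y| < 2^-1 ^+ n)%R]) M 1 (2^-1 `^ b) N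
    _ _ r01;
  last by exists c.
- by rewrite -lee_fin -muT.
- by [].
- move=> n; rewrite -muT le_measure ?inE//.
  exact: measurable_dist_lt.
move=> n Nn; rewrite mul1r.
have hn0 : 0 < (2^-1 : R) ^+ n by rewrite exprn_gt0// invr_gt0.
(* [j] is the index of the cell containing [x]. *)
pose j := Num.floor (x / 2^-1 ^+ n).
have jx : mesh (2^-1 ^+ n) j x.
  by rewrite /mesh /= in_itv /= -ler_pdivlMr// -ltr_pdivrMr// floor_itv.
apply: le_trans (measure_ball_le_mesh mu hn0 jx) _.
rewrite leNgt; apply/negP => /ltW heavy.
by apply: (FN _ Nn); exists j.
Qed.

Unset Implicit Arguments.

Theorem corollary1p5 (R : realType)
    (mu : {finite_measure set (measurableTypeR R) -> \bar R})
    (mu_continuous : forall x : R, mu [set x] = 0%E)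
    (m s : R) (s_ge0 : 0 <= s) (s_lt_m : s < m)
    (limsup_pos : exists A : set (measurableTypeR R),
      [/\ measurable A,
          (0 < mu A)%E &
          forall x : R, A x ->
            (0 < limf_esup
                   (fun eps : R =>
                      (eps `^ (- s))%:E * borel_transform mu m x eps)
                   0^'+)%E])
    (q : R) (q_gt1 : 1 < q) :
  (lower_multifractal_dim mu q <= s%:E)%E.
Proof.
rewrite leNgt; apply/negP => /(lower_multifractal_dim_gt q_gt1).
move=> [t [delta [st delta0 sum_le]]].
have [A [mA muA limsupA]] := limsup_pos.
(* Capping [t] at [m] ensures [a <= m], as the kernel bound requires; [a] and [b] then cut the
   interval from [s] to [t'] into thirds. *)
pose t' := Num.min t m.
have st' : s < t' by rewrite lt_min st.
have t't : t' <= t by rewrite ge_min lexx.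
have t'm : t' <= m by rewrite ge_min lexx orbT.
pose a := (2 * s + t') / 3; pose b := (s + 2 * t') / 3.
have [sa ab bt] : [/\ s < a, a < b & b < t] by split; rewrite /a /b; lra.
have am : 0 <= a <= m by rewrite /a; apply/andP; split; lra.
have b0 : 0 < b by lra.
have muF := measure_lim_sup_heavy_cells q_gt1 bt delta0 sum_le.
(* Outside the limsup set the upper limit would be at most 0, against the assumption on [A]; so [A]
   is contained in a null set. *)
have AF : A `<=` lim_sup_set (heavy_cells mu b).
  move=> x Ax; apply: contrapT => /(measure_ball_le_notin_lim_sup b0)[c muB].
  have [K JK] := borel_transform_le am ab muB.
  have := limsupA x Ax; rewrite ltNge => /negP; apply.
  exact: limf_esup_borel_transform_le0 sa JK.
move: muA; rewrite ltNge => /negP; apply; rewrite -muF.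
apply: le_measure => //; rewrite inE//.
apply: bigcapT_measurable => k; apply: bigcup_measurable => n _.
exact: measurable_heavy_cells.
Qed.
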